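(* Let $\Sigma$ be a plural signature. The assignment $\mathfrak{L}_{\Sigma}$ that sends an object $\boldsymbol{\mathcal{A}}=(\mathbf{I},\mathcal{A})$ of $\int^{\mathsf{NPIAlg}(\Sigma)_{\mathsf{s}}}\mathrm{Lsys}_{\Sigma}$ to $(\mathbf{I},(\boldsymbol{\mathfrak{L}}_{\Sigma}(\boldsymbol{\mathcal{A}}),\mathrm{p}_{\boldsymbol{\mathcal{A}}}))$ and a morphism $(t,u)\colon\boldsymbol{\mathcal{A}}\to\boldsymbol{\mathcal{B}}$ to $(t,u^{t})$ is a covariant functor from $\int^{\mathsf{NPIAlg}(\Sigma)_{\mathsf{s}}}\mathrm{Lsys}_{\Sigma}$ to $\int_{\mathsf{NPIAlg}(\Sigma)_{\mathsf{s}}}(\mathsf{Alg}(\Sigma)\downarrow_{\mathsf{s}}\cdot)$.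
   Context: A signature is a family $\Sigma=(\Sigma_n)_{n\in\mathbb{N}}$ of sets of $n$-ary operation symbols; it is plural if $\Sigma_0=\varnothing$ and $\Sigma_n\neq\varnothing$ for some $n\geq 2$. We write $n=\{0,\dots,n-1\}$. All $\Sigma$-algebras are non-empty (and have underlying sets in a fixed Grothendieck universe); $F^{\mathbf{A}}_\sigma$ is the operation of $\mathbf{A}$ (underlying set $A$) for $\sigma$. $\mathsf{Alg}(\Sigma)$ is the category of $\Sigma$-algebras and homomorphisms. **npi algebras.** For a $\Sigma$-algebra $\mathbf{I}$, $b\prec_{\mathbf{I}}a$ means that $a=F^{\mathbf{I}}_\sigma((a_j)_{j\in n})$ for some $n\ge 1$, $\sigma\in\Sigma_n$, $(a_j)_{j\in n}\in I^n$ with $b=a_j$ for some $j$; $\leq_{\mathbf{I}}$ is the reflexive transitive closure of $\prec_{\mathbf{I}}$ (homomorphisms are isotone for these preorders). $\mathbf{I}$ is idempotent if $F^{\mathbf{I}}_\sigma(i,\dots,i)=i$ for all $\sigma$ and $i$; it is naturally preordered if every $F^{\mathbf{I}}_\sigma$ is isotone for $\leq_{\mathbf{I}}$ (componentwise on $I^n$). An npi $\Sigma$-algebra is a naturally preordered idempotent one. $\mathsf{NPIAlg}(\Sigma)_{\mathsf{s}}$ is the category of npi $\Sigma$-algebras and surjective homomorphisms. **Lallement systems.** For a $\Sigma$-algebra $\mathbf{I}$, an $\mathbf{I}$-Lallement system of $\Sigma$-algebras is $\mathcal{A}=((\mathbf{A}_i,\mathbf{M}_i)_{i\in I},(f_{i,j})_{i\leq_{\mathbf{I}}j})$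 with $\mathbf{A}_i$ a subalgebra of $\mathbf{M}_i$ and homomorphisms $f_{i,j}\colon\mathbf{A}_i\to\mathbf{M}_j$ such that, for all $\sigma\in\Sigma_n$, $(i_k)_{k\in n}\in I^n$ with $i=F^{\mathbf{I}}_\sigma((i_k)_{k\in n})$ and $(a_{k})_{k\in n}\in\prod_{k\in n}A_{i_k}$: (a) $F^{\mathbf{M}_i}_\sigma((f_{i_k,i}(a_k))_{k\in n})\in A_i$; (b) for all $j$ with $i\leq_{\mathbf{I}}j$, $f_{i,j}(F^{\mathbf{M}_i}_\sigma((f_{i_k,i}(a_k))_{k\in n}))=F^{\mathbf{M}_j}_\sigma((f_{i_k,j}(a_k))_{k\in n})$. (It is not required here that $f_{i,i}$ be the inclusion.) A morphism from $\mathcal{A}$ to $\mathcal{B}=((\mathbf{B}_i,\mathbf{N}_i)_{i\in I},(g_{i,j})_{i\leq_{\mathbf{I}}j})$ is a family of homomorphisms $u_i\colon\mathbf{M}_i\to\mathbf{N}_i$ with $u_i[A_i]\subseteq B_i$ and, for $i\leq_{\mathbf{I}}j$, $u_j\circ f_{i,j}=g_{i,j}\circ u_i|_{A_i}$. For a homomorphism $t\colon\mathbf{I}\to\mathbf{P}$ and a $\mathbf{P}$-Lallement system $\mathcal{B}$, $\mathcal{B}_t=((\mathbf{B}_{t(i)},\mathbf{N}_{t(i)})_{i\in I},(g_{t(i),t(j)})_{i\leq_{\mathbf{I}}j})$, an $\mathbf{I}$-Lallement system. **Source category.** $\int^{\mathsf{NPIAlg}(\Sigma)_{\mathsf{s}}}\mathrm{Lsys}_\Sigma$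 has objects $\boldsymbol{\mathcal{A}}=(\mathbf{I},\mathcal{A})$, with $\mathbf{I}$ npi and $\mathcal{A}$ an $\mathbf{I}$-Lallement system; a morphism $(\mathbf{I},\mathcal{A})\to(\mathbf{P},\mathcal{B})$ is a pair $(t,u)$ with $t\colon\mathbf{I}\to\mathbf{P}$ a surjective homomorphism and $u=(u_i)_{i\in I}\colon\mathcal{A}\to\mathcal{B}_t$ a morphism of $\mathbf{I}$-Lallement systems; composition is $(s,v)\circ(t,u)=(s\circ t,(v_{t(i)}\circ u_i)_{i\in I})$, with the evident identities. **Target category.** $\int_{\mathsf{NPIAlg}(\Sigma)_{\mathsf{s}}}(\mathsf{Alg}(\Sigma)\downarrow_{\mathsf{s}}\cdot)$ has objects $(\mathbf{I},(\mathbf{A},f))$, with $\mathbf{I}$ npi, $\mathbf{A}$ a $\Sigma$-algebra and $f\colon\mathbf{A}\to\mathbf{I}$ a surjective homomorphism; a morphism $(\mathbf{I},(\mathbf{A},f))\to(\mathbf{P},(\mathbf{B},g))$ is a pair $(t,h)$ with $t\colon\mathbf{I}\to\mathbf{P}$ a surjective homomorphism and $h\colon\mathbf{A}\to\mathbf{B}$ a homomorphism with $t\circ f=g\circ h$; composition is componentwise. **Lallement sum.** $\boldsymbol{\mathfrak{L}}_\Sigma(\boldsymbol{\mathcal{A}})$ is the $\Sigma$-algebra with underlying set $\coprod_{i\in I}A_i=\bigcup_{i\in I}(A_i\times\{i\})$ and operations $F_\sigma((a_k,i_k)_{k\in n})=(F^{\mathbf{M}_i}_\sigma((f_{i_k,i}(a_k))_{k\in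 n}),i)$ with $i=F^{\mathbf{I}}_\sigma((i_k)_{k\in n})$; $\mathrm{p}_{\boldsymbol{\mathcal{A}}}\colon\boldsymbol{\mathfrak{L}}_\Sigma(\boldsymbol{\mathcal{A}})\to\mathbf{I}$ is $(a,i)\mapsto i$. For a morphism $(t,u)\colon\boldsymbol{\mathcal{A}}\to\boldsymbol{\mathcal{B}}$, $u^t\colon\boldsymbol{\mathfrak{L}}_\Sigma(\boldsymbol{\mathcal{A}})\to\boldsymbol{\mathfrak{L}}_\Sigma(\boldsymbol{\mathcal{B}})$ is the mapping $u^t(a,i)=(u_i(a),t(i))$. *)

(* Defs.v *)
From Stdlib Require Import Relation_Operators.
From mathcomp Require Import all_boot boolp.
Set Implicit Arguments.
Unset Strict Implicit.
Unset Printing Implicit Defensive.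

Record category := Category {
  ob :> Type;
  mor : ob -> ob -> Type;
  idm : forall a, mor a a;
  compm : forall a b c, mor b c -> mor a b -> mor a c;
  compm_idl : forall a b (f : mor a b), compm (idm b) f = f;
  compm_idr : forall a b (f : mor a b), compm f (idm a) = f;
  compmA : forall a b c d (h : mor c d) (g : mor b c) (f : mor a b),
    compm h (compm g f) = compm (compm h g) f
}.
Arguments idm {_} _.
Arguments compm {_ _ _ _} _ _.

Definition is_functor (C D : category) (Fo : C -> D)
    (Fm : forall a b : C, mor a b -> mor (Fo a) (Fo b)) : Prop :=
  (forall a, Fm a a (idm a) = idm (Fo a)) /\
  (forall a b c (g : mor b c) (f : mor a b),
     Fm a c (compm g f) = compm (Fm b c g) (Fm a b f)).

(* The sets of the fixed Grothendieck universe are the types of a universe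
   [Type]; the elements of A^n are the functions 'I_n -> A. *)

Definition signature := nat -> Type.

Definition plural (Sg : signature) : Prop :=
  (Sg 0 -> False) /\ exists n, (2 <= n)%N /\ inhabited (Sg n).

Record algebra (Sg : signature) := Algebra {
  carrier :> Type;
  aop : forall n, Sg n -> ('I_n -> carrier) -> carrier;
  carrier_inhabited : inhabited carrier
}.
Arguments aop {Sg a n}.

Definition is_hom (Sg : signature) (A B : algebra Sg) (f : A -> B) : Prop :=
  forall n (s : Sg n) (a : 'I_n -> A),
    f (aop s a) = aop s (fun k => f (a k)).

Record ahom (Sg : signature) (A B : algebra Sg) := AHom {
  ahom_fun :> A -> B;
  ahomP : is_hom ahom_fun
}.

Definition surj (A B : Type) (f : A -> B) : Prop := forall b, exists a, f a = b.

Record shom (Sg : signature) (A B : algebra Sg) := SHom {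
  shom_hom :> ahom A B;
  shomP : surj shom_hom
}.

Lemma ahom_eq (Sg : signature) (A B : algebra Sg) (f g : ahom A B) :
  (forall x, f x = g x) -> f = g.
Proof.
case: f g => [f fP] [g gP] /= /funext fg.
by subst g; congr AHom; exact: Prop_irrelevance.
Qed.

Lemma shom_eq (Sg : signature) (A B : algebra Sg) (f g : shom A B) :
  (forall x, f x = g x) -> f = g.
Proof.
case: f g => [f fP] [g gP] /= /ahom_eq fg.
by subst g; congr SHom; exact: Prop_irrelevance.
Qed.

Lemma is_hom_id (Sg : signature) (A : algebra Sg) : is_hom (fun x : A => x).
Proof. by []. Qed.

Lemma is_hom_comp (Sg : signature) (A B C : algebra Sg)
  (g : ahom B C) (f : ahom A B) : is_hom (fun x => g (f x)).
Proof. by move=> n s a; rewrite !ahomP. Qed.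

Definition ahom_id (Sg : signature) (A : algebra Sg) : ahom A A :=
  AHom (@is_hom_id Sg A).

Definition ahom_comp (Sg : signature) (A B C : algebra Sg)
  (g : ahom B C) (f : ahom A B) : ahom A C := AHom (is_hom_comp g f).

Lemma surj_id (A : Type) : surj (fun x : A => x).
Proof. by move=> x; exists x. Qed.

Lemma surj_comp (A B C : Type) (g : B -> C) (f : A -> B) :
  surj g -> surj f -> surj (fun x => g (f x)).
Proof. by move=> gP fP c; have [b <-] := gP c; have [a <-] := fP b; exists a. Qed.

Definition shom_id (Sg : signature) (A : algebra Sg) : shom A A :=
  @SHom Sg A A (ahom_id A) (@surj_id A).

Definition shom_comp (Sg : signature) (A B C : algebra Sg)
  (g : shom B C) (f : shom A B) : shom A C :=
  @SHom Sg A C (ahom_comp g f) (surj_comp (shomP g) (shomP f)).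

Definition nprec (Sg : signature) (I : algebra Sg) (b a : I) : Prop :=
  exists n (s : Sg n) (a_ : 'I_n -> I),
    (1 <= n)%N /\ a = aop s a_ /\ exists j, b = a_ j.

Definition nle (Sg : signature) (I : algebra Sg) : I -> I -> Prop :=
  clos_refl_trans I (@nprec Sg I).

Lemma nle_trans (Sg : signature) (I : algebra Sg) (i j k : I) :
  nle i j -> nle j k -> nle i k.
Proof. exact: rt_trans. Qed.

Lemma nle_arg (Sg : signature) (I : algebra Sg) n (s : Sg n) (i_ : 'I_n -> I)
  (i : I) : i = aop s i_ -> forall k, nle (i_ k) i.
Proof.
move=> iE k; apply: rt_step; exists n, s, i_; split; last by split=> //; exists k.
by apply: leq_ltn_trans (ltn_ord k).
Qed.

Lemma nle_hom (Sg : signature) (I P : algebra Sg) (t : ahom I P) (i j : I) :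
  nle i j -> nle (t i) (t j).
Proof.
elim=> [x y [n [s [a_ [n1 [-> [k ->]]]]]]|x|x y z _ IH1 _ IH2].
- by rewrite ahomP; exact: (nle_arg (i_ := fun k => t (a_ k)) erefl).
- exact: rt_refl.
- exact: nle_trans IH1 IH2.
Qed.

Definition idempotent_alg (Sg : signature) (I : algebra Sg) : Prop :=
  forall n (s : Sg n) (i : I), aop s (fun=> i) = i.

Definition naturally_preordered (Sg : signature) (I : algebra Sg) : Prop :=
  forall n (s : Sg n) (x y : 'I_n -> I),
    (forall k, nle (x k) (y k)) -> nle (aop s x) (aop s y).

Record npi_algebra (Sg : signature) := NpiAlgebra {
  npi_alg :> algebra Sg;
  npi_natural : naturally_preordered npi_alg;
  npi_idempotent : idempotent_alg npi_alg
}.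

Record subalgebra (Sg : signature) (M : algebra Sg) := Subalgebra {
  sub_pred :> M -> Prop;
  sub_nonempty : exists x, sub_pred x;
  sub_closed : forall n (s : Sg n) (a : 'I_n -> M),
    (forall k, sub_pred (a k)) -> sub_pred (aop s a)
}.

Definition sub_op (Sg : signature) (M : algebra Sg) (A : subalgebra M)
    n (s : Sg n) (a : 'I_n -> {x : M | A x}) : {x : M | A x} :=
  exist A (aop s (fun k => proj1_sig (a k)))
        (sub_closed s (fun k => proj2_sig (a k))).

Lemma sub_inhabited (Sg : signature) (M : algebra Sg) (A : subalgebra M) :
  inhabited {x : M | A x}.
Proof. by have [x Ax] := sub_nonempty A; constructor; exists x. Qed.

Definition subalg (Sg : signature) (M : algebra Sg) (A : subalgebra M) :
  algebra Sg := Algebra (@sub_op Sg M A) (sub_inhabited A).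

(* Lallement systems.  The homomorphisms f_{i,j} are indexed by proofs of
   i <= j; by proof irrelevance this is a family indexed by the pairs (i, j)
   with i <= j.  The index i = F_s(i_k) is a variable with an equation, so that
   the conditions can be transported along homomorphisms of the base. *)

Record lsystem (Sg : signature) (I : algebra Sg) := LSystem {
  lsM : I -> algebra Sg;
  lsA : forall i, subalgebra (lsM i);
  lsf : forall i j, nle i j -> ahom (subalg (lsA i)) (lsM j);
  lsf_closed : forall n (s : Sg n) (i_ : 'I_n -> I) (i : I)
      (iE : i = aop s i_) (a : forall k, subalg (lsA (i_ k))),
    lsA i (aop s (fun k => lsf (nle_arg iE k) (a k)));
  lsf_compat : forall n (s : Sg n) (i_ : 'I_n -> I) (i : I)
      (iE : i = aop s i_) (a : forall k, subalg (lsA (i_ k)))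
      (j : I) (ij : nle i j),
    lsf ij (exist (lsA i) (aop s (fun k => lsf (nle_arg iE k) (a k)))
                  (lsf_closed iE a)) =
    aop s (fun k => lsf (nle_trans (nle_arg iE k) ij) (a k))
}.
Arguments lsM {Sg I}.
Arguments lsA {Sg I}.
Arguments lsf {Sg I} l {i j}.
Arguments lsf_closed {Sg I} l {n s i_ i}.

Lemma lsf_irr (Sg : signature) (I : algebra Sg) (X : lsystem I) (i j : I)
    (h h' : nle i j) (a : lsM X i) (p q : lsA X i a) :
  lsf X h (exist _ a p) = lsf X h' (exist _ a q).
Proof. by rewrite (Prop_irrelevance h h') (Prop_irrelevance p q). Qed.

Record lsys_hom (Sg : signature) (I : algebra Sg) (X Y : lsystem I) :=
  LSysHom {
    lsh :> forall i, ahom (lsM X i) (lsM Y i);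
    lsh_sub : forall i x, lsA X i x -> lsA Y i (lsh i x);
    lsh_nat : forall i j (ij : nle i j) (x : subalg (lsA X i)),
      lsh j (lsf X ij x) =
      lsf Y ij (exist (lsA Y i) (lsh i (proj1_sig x)) (lsh_sub (proj2_sig x)))
  }.
Arguments lsh_sub {Sg I X Y} l {i x}.

Lemma lsys_hom_eq (Sg : signature) (I : algebra Sg) (X Y : lsystem I)
  (u v : lsys_hom X Y) : (forall i x, u i x = v i x) -> u = v.
Proof.
case: u v => [u uA uf] [v vA vf] /= uv.
have {uv} uv : u = v by apply: functional_extensionality_dep => i; apply: ahom_eq.
subst v; rewrite (Prop_irrelevance vA uA) in vf *.
by congr LSysHom; exact: Prop_irrelevance.
Qed.

(* The system B_t, with components B_{t(i)}, N_{t(i)} and g_{t(i),t(j)}; its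
   conditions at i = F_s(i_k) are those of B at t(i) = F_s(t(i_k)). *)
Section Reindex.
Variables (Sg : signature) (I P : algebra Sg) (t : ahom I P) (B : lsystem P).

Let rf (i j : I) (ij : nle i j) : ahom (subalg (lsA B (t i))) (lsM B (t j)) :=
  lsf B (nle_hom t ij).

Let op_image n (s : Sg n) (i_ : 'I_n -> I) (i : I) :
  i = aop s i_ -> t i = aop s (fun k => t (i_ k)).
Proof. by move=> ->; rewrite ahomP. Qed.

Lemma reindex_closed n (s : Sg n) (i_ : 'I_n -> I) (i : I)
    (iE : i = aop s i_) (a : forall k, subalg (lsA B (t (i_ k)))) :
  lsA B (t i) (aop s (fun k => rf (nle_arg iE k) (a k))).
Proof.
have := lsf_closed B (op_image iE) a; congr (lsA B (t i) (aop s _)).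
by apply: funext => k; rewrite /rf (Prop_irrelevance (nle_hom _ _) (nle_arg (op_image iE) k)).
Qed.

Lemma reindex_compat n (s : Sg n) (i_ : 'I_n -> I) (i : I)
    (iE : i = aop s i_) (a : forall k, subalg (lsA B (t (i_ k))))
    (j : I) (ij : nle i j) :
  rf ij (exist (lsA B (t i)) (aop s (fun k => rf (nle_arg iE k) (a k)))
               (reindex_closed iE a)) =
  aop s (fun k => rf (nle_trans (nle_arg iE k) ij) (a k)).
Proof.
have := lsf_compat (op_image iE) a (nle_hom t ij).
have aE : (fun k => lsf B (nle_arg (op_image iE) k) (a k)) =
          (fun k => rf (nle_arg iE k) (a k)).
  by apply: funext => k; rewrite /rf (Prop_irrelevance (nle_hom _ _) (nle_arg (op_image iE) k)).
move: (lsf_closed B (op_image iE) a); rewrite aE => c.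
rewrite (Prop_irrelevance (reindex_closed iE a) c) => ->; congr (aop s _).
by apply: funext => k; rewrite /rf; congr (lsf B _ (a k)); exact: Prop_irrelevance.
Qed.

Definition reindex : lsystem I := LSystem reindex_compat.

End Reindex.

Record lsys_obj (Sg : signature) := LSysObj {
  lo_base : npi_algebra Sg;
  lo_sys : lsystem lo_base
}.

Record lsys_mor (Sg : signature) (A B : lsys_obj Sg) := LSysMor {
  lm_base : shom (lo_base A) (lo_base B);
  lm_sys : lsys_hom (lo_sys A) (reindex lm_base (lo_sys B))
}.

Section LSysCategory.
Variable Sg : signature.

Lemma lsys_mor_eq (A B : lsys_obj Sg) (t : lo_base A -> lo_base B)
    (h1 h2 : is_hom t) (s1 s2 : surj t)
    (u : lsys_hom (lo_sys A) (reindex (AHom h1) (lo_sys B)))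
    (v : lsys_hom (lo_sys A) (reindex (AHom h2) (lo_sys B))) :
  (forall i x, u i x = v i x) ->
  @LSysMor Sg A B (@SHom Sg _ _ (AHom h1) s1) u =
  @LSysMor Sg A B (@SHom Sg _ _ (AHom h2) s2) v.
Proof.
have e : h1 = h2 by exact: Prop_irrelevance.
subst h2; rewrite (Prop_irrelevance s2 s1) => uv; congr LSysMor.
exact: lsys_hom_eq.
Qed.

Section Id.
Variable A : lsys_obj Sg.
Let idu (i : lo_base A) :
    ahom (lsM (lo_sys A) i) (lsM (reindex (shom_id (lo_base A)) (lo_sys A)) i) :=
  ahom_id (lsM (lo_sys A) i).

Lemma idu_sub i x :
  lsA (lo_sys A) i x ->
  lsA (reindex (shom_id (lo_base A)) (lo_sys A)) i (idu i x).
Proof. by []. Qed.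

Lemma idu_nat i j (ij : nle i j) (x : subalg (lsA (lo_sys A) i)) :
  idu j (lsf (lo_sys A) ij x) =
  lsf (reindex (shom_id (lo_base A)) (lo_sys A)) ij
    (exist (lsA (reindex (shom_id (lo_base A)) (lo_sys A)) i)
       (idu i (proj1_sig x)) (idu_sub (proj2_sig x))).
Proof.
case: x => x Ax /=.
exact: (lsf_irr (X := lo_sys A)).
Qed.

Definition lsys_id : lsys_mor A A :=
  @LSysMor Sg A A (shom_id (lo_base A)) (LSysHom idu_nat).
End Id.

Section Comp.
Variables (A B C : lsys_obj Sg) (g : lsys_mor B C) (f : lsys_mor A B).
Let st := shom_comp (lm_base g) (lm_base f).
Let compu (i : lo_base A) :
    ahom (lsM (lo_sys A) i) (lsM (reindex st (lo_sys C)) i) :=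
  ahom_comp (lm_sys g (lm_base f i)) (lm_sys f i).

Lemma compu_sub i x :
  lsA (lo_sys A) i x -> lsA (reindex st (lo_sys C)) i (compu i x).
Proof.
move=> Ax.
exact: (@lsh_sub _ _ _ _ (lm_sys g) (lm_base f i) _ (lsh_sub (lm_sys f) Ax)).
Qed.

Lemma compu_nat i j (ij : nle i j) (x : subalg (lsA (lo_sys A) i)) :
  compu j (lsf (lo_sys A) ij x) =
  lsf (reindex st (lo_sys C)) ij
    (exist (lsA (reindex st (lo_sys C)) i)
       (compu i (proj1_sig x)) (compu_sub (proj2_sig x))).
Proof.
rewrite /= lsh_nat /= lsh_nat /=.
exact: lsf_irr.
Qed.

Definition lsys_comp : lsys_mor A C := @LSysMor Sg A C st (LSysHom compu_nat).
End Comp.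

Lemma lsys_comp_idl (A B : lsys_obj Sg) (f : lsys_mor A B) :
  lsys_comp (lsys_id B) f = f.
Proof. by case: f => [[[t th] ts] u]; exact: lsys_mor_eq. Qed.

Lemma lsys_comp_idr (A B : lsys_obj Sg) (f : lsys_mor A B) :
  lsys_comp f (lsys_id A) = f.
Proof. by case: f => [[[t th] ts] u]; exact: lsys_mor_eq. Qed.

Lemma lsys_compA (A B C D : lsys_obj Sg)
    (h : lsys_mor C D) (g : lsys_mor B C) (f : lsys_mor A B) :
  lsys_comp h (lsys_comp g f) = lsys_comp (lsys_comp h g) f.
Proof. exact: lsys_mor_eq. Qed.

Definition lsys_category : category :=
  Category lsys_comp_idl lsys_comp_idr lsys_compA.

End LSysCategory.

Record slice_obj (Sg : signature) := SliceObj {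
  so_base : npi_algebra Sg;
  so_alg : algebra Sg;
  so_map : shom so_alg so_base
}.

Record slice_mor (Sg : signature) (A B : slice_obj Sg) := SliceMor {
  sm_base : shom (so_base A) (so_base B);
  sm_alg : ahom (so_alg A) (so_alg B);
  sm_comm : forall x, sm_base (so_map A x) = so_map B (sm_alg x)
}.

Section SliceCategory.
Variable Sg : signature.

Lemma slice_mor_eq (A B : slice_obj Sg) (f g : slice_mor A B) :
  (forall i, sm_base f i = sm_base g i) ->
  (forall x, sm_alg f x = sm_alg g x) -> f = g.
Proof.
case: f g => [t h c] [t' h' c'] /= /shom_eq e /ahom_eq e'.
by subst t' h'; congr SliceMor; exact: Prop_irrelevance.
Qed.

Definition slice_id (A : slice_obj Sg) : slice_mor A A :=
  @SliceMor Sg A A (shom_id (so_base A)) (ahom_id (so_alg A)) (fun=> erefl).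

Lemma slice_comp_comm (A B C : slice_obj Sg) (g : slice_mor B C)
    (f : slice_mor A B) x :
  shom_comp (sm_base g) (sm_base f) (so_map A x) =
  so_map C (ahom_comp (sm_alg g) (sm_alg f) x).
Proof. by rewrite /= !sm_comm. Qed.

Definition slice_comp (A B C : slice_obj Sg) (g : slice_mor B C)
    (f : slice_mor A B) : slice_mor A C :=
  @SliceMor Sg A C (shom_comp (sm_base g) (sm_base f))
    (ahom_comp (sm_alg g) (sm_alg f)) (slice_comp_comm g f).

Lemma slice_comp_idl (A B : slice_obj Sg) (f : slice_mor A B) :
  slice_comp (slice_id B) f = f.
Proof. exact: slice_mor_eq. Qed.

Lemma slice_comp_idr (A B : slice_obj Sg) (f : slice_mor A B) :
  slice_comp f (slice_id A) = f.
Proof. exact: slice_mor_eq. Qed.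

Lemma slice_compA (A B C D : slice_obj Sg)
    (h : slice_mor C D) (g : slice_mor B C) (f : slice_mor A B) :
  slice_comp h (slice_comp g f) = slice_comp (slice_comp h g) f.
Proof. exact: slice_mor_eq. Qed.

Definition slice_category : category :=
  Category slice_comp_idl slice_comp_idr slice_compA.

End SliceCategory.

(* The Lallement sum; its elements (a, i) are written with the index first. *)

Section LallementSum.
Variables (Sg : signature) (A : lsys_obj Sg).
Notation I := (lo_base A).
Notation X := (lo_sys A).

Definition lsum_carrier : Type := {i : I & {a : lsM X i | lsA X i a}}.

Definition lsum_op n (s : Sg n) (x : 'I_n -> lsum_carrier) : lsum_carrier :=
  let i_ := fun k => projT1 (x k) in
  let iE : aop s i_ = aop s i_ := erefl in
  existT _ (aop s i_)
    (exist (lsA X (aop s i_))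
       (aop s (fun k => lsf X (nle_arg iE k) (projT2 (x k))))
       (lsf_closed X iE (fun k => projT2 (x k)))).

Lemma lsum_inhabited : inhabited lsum_carrier.
Proof.
have [i] := carrier_inhabited I; have [a] := sub_inhabited (lsA X i).
by constructor; exists i.
Qed.

Definition lsum : algebra Sg := Algebra lsum_op lsum_inhabited.

Definition lsum_proj (x : lsum) : I := projT1 x.

End LallementSum.

(* (a, i) |-> (u_i(a), t(i)), with projections instead of pattern matching so
   that it reduces on a variable. *)
Definition lsum_map (Sg : signature) (A B : lsys_obj Sg) (f : lsys_mor A B)
    (x : lsum A) : lsum B :=
  let i := projT1 x in
  existT _ (lm_base f i)
    (exist (lsA (lo_sys B) (lm_base f i))
       (lm_sys f i (proj1_sig (projT2 x)))
       (lsh_sub (lm_sys f) (proj2_sig (projT2 x)))).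

(* Main.v *)
Require Import Defs.
From mathcomp Require Import all_boot boolp.

Set Implicit Arguments.
Unset Strict Implicit.

(** The only substantial point is that u^t preserves operations ([lsum_map_hom]). Both sides lie
    over t(F(i_k)) = F(t(i_k)); over that index they agree because u_i is a homomorphism and the
    family u commutes with the structure maps [lsf]. The functor laws then hold elementwise, since u
    is composed fibre by fibre along t. *)

Lemma lsum_eq (Sg : signature) (A : lsys_obj Sg) (i : lo_base A)
    (a b : {a : lsM (lo_sys A) i | lsA (lo_sys A) i a}) :
  proj1_sig a = proj1_sig b -> existT _ i a = existT _ i b :> lsum A.
Proof.
case: a b => [a p] [b q] /= ab; move: p; rewrite ab => p.
by rewrite (Prop_irrelevance p q).
Qed.

(* Leaving the index [i] free up to [iE] absorbs the transport along
   [t (aop s i_) = aop s (t \o i_)] in [lsum_map_hom]. *)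
Lemma lsum_opE (Sg : signature) (A : lsys_obj Sg) n (s : Sg n)
    (i : lo_base A) (x : 'I_n -> lsum A)
    (iE : i = aop s (fun k => projT1 (x k))) :
  aop s x =
  existT _ i (exist (lsA (lo_sys A) i)
    (aop s (fun k => lsf (lo_sys A) (nle_arg iE k) (projT2 (x k))))
    (lsf_closed (lo_sys A) iE (fun k => projT2 (x k)))) :> lsum A.
Proof. by subst i. Qed.

Lemma lsum_proj_hom (Sg : signature) (A : lsys_obj Sg) :
  is_hom (@lsum_proj Sg A).
Proof. by []. Qed.

Lemma lsum_proj_surj (Sg : signature) (A : lsys_obj Sg) :
  surj (@lsum_proj Sg A).
Proof.
(* Every fibre is inhabited because subalgebras are non-empty. *)
by move=> i; have [a] := sub_inhabited (lsA (lo_sys A) i); exists (existT _ i a).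
Qed.

Lemma lsum_map_hom (Sg : signature) (A B : lsys_obj Sg) (f : lsys_mor A B) :
  is_hom (lsum_map f).
Proof.
move=> n s x.
have tE : lm_base f (aop s (fun k => projT1 (x k))) =
    aop s (fun k => projT1 (lsum_map f (x k))) by rewrite ahomP.
rewrite (lsum_opE tE); apply: lsum_eq => /=.
rewrite (ahomP (lm_sys f _)); congr (aop s _); apply: funext => k.
(* Naturality moves u past the structure map; the two sides then differ only in the proofs of t(i_k)
   <= t(i) and of membership. *)
by rewrite lsh_nat /=; exact: lsf_irr.
Qed.

Lemma lsum_map_id (Sg : signature) (A : lsys_obj Sg) (x : lsum A) :
  lsum_map (lsys_id A) x = x.
Proof. by case: x => i a; apply: lsum_eq. Qed.

Lemma lsum_map_comp (Sg : signature) (A B C : lsys_obj Sg)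
    (g : lsys_mor B C) (f : lsys_mor A B) (x : lsum A) :
  lsum_map (lsys_comp g f) x = lsum_map g (lsum_map f x).
Proof. exact: lsum_eq. Qed.

(* The well-definedness of the two assignments, i.e. that [lsum_proj] is a
   surjective homomorphism and that (t, u^t) is a morphism of the target
   category, is part of the claim. *)
Theorem proposition5p5 (Sg : signature) (Sg_plural : plural Sg) :
  exists (p_hom : forall A : lsys_obj Sg, is_hom (@lsum_proj Sg A))
         (p_surj : forall A : lsys_obj Sg, surj (@lsum_proj Sg A)),
  let Lo (A : lsys_obj Sg) : slice_obj Sg :=
    @SliceObj Sg (lo_base A) (lsum A)
      (@SHom Sg (lsum A) (lo_base A) (AHom (p_hom A)) (p_surj A)) in
  exists (u_hom : forall (A B : lsys_obj Sg) (f : lsys_mor A B),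
            is_hom (lsum_map f))
         (u_comm : forall (A B : lsys_obj Sg) (f : lsys_mor A B) (x : lsum A),
            lm_base f (lsum_proj x) = lsum_proj (lsum_map f x)),
  let Lm (A B : lsys_obj Sg) (f : lsys_mor A B) : slice_mor (Lo A) (Lo B) :=
    @SliceMor Sg (Lo A) (Lo B) (lm_base f) (AHom (u_hom A B f))
      (u_comm A B f) in
  @is_functor (lsys_category Sg) (slice_category Sg) Lo Lm.
Proof.
exists (@lsum_proj_hom Sg), (@lsum_proj_surj Sg) => Lo.
exists (@lsum_map_hom Sg), (fun A B f x => erefl) => Lm.
split=> [A|A B C g f]; apply: slice_mor_eq => // x.
- exact: lsum_map_id.
- exact: lsum_map_comp.
Qed.
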